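(* Let $k\ge 2$ and $d\ge 1$ be integers. For the online (integral) matching problem on $k$-uniform hypergraphs under vertex arrivals, restricted to instances in which every online node has degree at most $d$, the competitive ratio of the algorithm RANDOM is at least $$\min\left(\frac{1}{k-1},\ \frac{d}{(d-1)k+1}\right).$$ That is, for every such instance $\mathcal H$, the expected size of the matching produced by RANDOM is at least $\min\left(\frac{1}{k-1},\frac{d}{(d-1)k+1}\right)\cdot \mathsf{OPT}(\mathcal H)$.
   Context: An instance is a finite $k$-uniform hypergraph $\mathcal H=(V,W,H)$ with offline nodes $V$, a finite sequence $W$ of online nodes, and hyperedges $H$, each containing exactly one node of $W$ and exactly $k-1$ nodes of $V$. The online nodes arrive one by one in the order of $W$; when $w$ arrives, the set $\delta(w)$ of hyperedges containing $w$ is revealed. The degree of $w$ is $|\delta(w)|$. A matching is a set of pairwise disjoint hyperedges, and $\mathsf{OPT}(\mathcal H)$ is the maximum size of a matching in $\mathcal H$. Algorithm RANDOM maintains a matching $\mathcal M$, initially empty. When an online node $w$ arrives, it considers the hyperedges of $\delta(w)$ that are disjoint from all hyperedges currently in $\mathcal M$; if there is at least one, it picks one of them uniformly at random (with fresh independent randomness) and adds it to $\mathcal M$; otherwise it does nothing. Its output is the final $\mathcal M$. The instance is fixed independently of the random choices. *)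

(* Defs.v *)
From mathcomp Require Import all_boot all_order all_algebra.

Set Implicit Arguments.
Unset Strict Implicit.
Unset Printing Implicit Defensive.

Import Order.TTheory GRing.Theory Num.Theory.
Local Open Scope ring_scope.

(* [T] is only an ambient finite universe of nodes; the nodes of the instance
   are those of [offline] and [online], the latter in order of arrival. *)
Record instance (T : finType) (k : nat) := Instance {
  offline : {set T};
  online : seq T;
  hedges : {set {set T}};
  online_uniq : uniq online;
  online_offline : [disjoint online & offline];
  hedges_nodes : forall h, h \in hedges -> h \subset offline :|: [set:: online];
  hedges_online : forall h, h \in hedges -> #|h :&: [set:: online]| = 1%N;
  hedges_offline : forall h, h \in hedges -> #|h :&: offline| = (k - 1)%N
}.

Definition delta (T : finType) (k : nat) (G : instance T k) (w : T) :
    {set {set T}} :=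
  [set h in hedges G | w \in h].

Definition degree (T : finType) (k : nat) (G : instance T k) (w : T) : nat :=
  #|delta G w|.

Definition matching (T : finType) (k : nat) (G : instance T k)
    (M : {set {set T}}) : bool :=
  (M \subset hedges G) && trivIset M.

Definition OPT (T : finType) (k : nat) (G : instance T k) : nat :=
  (\max_(M : {set {set T}} | matching G M) #|M|)%N.

Definition available (T : finType) (k : nat) (G : instance T k)
    (M : {set {set T}}) (w : T) : {set {set T}} :=
  [set h in delta G w | [forall g in M, [disjoint h & g]]].

(* Probability that RANDOM's matching is [M'] just after the arrival of [w],
   given that it was [M] just before. *)
Definition random_step (R : realFieldType) (T : finType) (k : nat)
    (G : instance T k) (w : T) (M M' : {set {set T}}) : R :=
  if available G M w == set0 then (M' == M)%:R
  else \sum_(h in available G M w) #|available G M w|%:R^-1 * (M' == h |: M)%:R.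

(* Probability mass function of RANDOM's matching after the arrivals [s];
   chaining the steps as a Markov chain encodes the fresh randomness. *)
Definition random_law (R : realFieldType) (T : finType) (k : nat)
    (G : instance T k) (s : seq T) : {set {set T}} -> R :=
  foldl (fun (mu : {set {set T}} -> R) w M' =>
           \sum_(M : {set {set T}}) mu M * random_step R G w M M')
        (fun M => (M == set0)%:R) s.

Definition expected_size (R : realFieldType) (T : finType) (k : nat)
    (G : instance T k) : R :=
  \sum_(M : {set {set T}}) random_law R G (online G) M * #|M|%:R.

Lemma random_step_ge0 (R : realFieldType) (T : finType) (k : nat)
    (G : instance T k) (w : T) (M M' : {set {set T}}) :
  0 <= random_step R G w M M'.
Proof.
rewrite /random_step; case: ifP => _; first exact: ler0n.
by apply: sumr_ge0 => h _; rewrite mulr_ge0 ?invr_ge0 ?ler0n.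
Qed.

Lemma sum_random_step (R : realFieldType) (T : finType) (k : nat)
    (G : instance T k) (w : T) (M : {set {set T}}) :
  \sum_(M' : {set {set T}}) random_step R G w M M' = 1.
Proof.
have sum_eq (N : {set {set T}}) :
    \sum_(M' : {set {set T}}) (M' == N)%:R = 1 :> R.
  by rewrite (bigD1 N) //= eqxx big1 ?addr0 // => N' /negPf ->.
rewrite /random_step; case: (boolP (available G M w == set0)) => [_|A0].
  exact: sum_eq.
rewrite exchange_big /=.
rewrite (eq_bigr (fun=> #|available G M w|%:R^-1)); last first.
  by move=> h _; rewrite -mulr_sumr sum_eq mulr1.
by rewrite sumr_const -[LHS]mulr_natl divff // pnatr_eq0 cards_eq0.
Qed.

Lemma random_law_ge0 (R : realFieldType) (T : finType) (k : nat)
    (G : instance T k) (s : seq T) (M : {set {set T}}) :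
  0 <= random_law R G s M.
Proof.
elim/last_ind: s M => [|s w IHs] M; first exact: ler0n.
rewrite /random_law foldl_rcons; apply: sumr_ge0 => N _.
by rewrite mulr_ge0 ?random_step_ge0 ?IHs.
Qed.

Lemma sum_random_law (R : realFieldType) (T : finType) (k : nat)
    (G : instance T k) (s : seq T) :
  \sum_(M : {set {set T}}) random_law R G s M = 1.
Proof.
elim/last_ind: s => [|s w IHs].
  by rewrite /random_law /= (bigD1 set0) //= eqxx big1 ?addr0 // => N /negbTE ->.
rewrite /random_law foldl_rcons exchange_big /= -[RHS]IHs.
by apply: eq_bigr => N _; rewrite -mulr_sumr sum_random_step mulr1.
Qed.

(* Main.v *)
(* Fix a matching [O], and call a hyperedge of [O] hit by [M] when it meets a
   member of [M].  After all arrivals every member of [O] is hit.  When RANDOM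
   adds a hyperedge at the arrival of [w], either the member of [O] at [w] is
   absent or already hit, and the new hyperedge hits at most [k - 1] further
   members of [O] through its offline nodes; or that member is one of the
   [a <= d] available hyperedges, and then it is itself selected with
   probability [1 / a], hitting only itself, while any other choice hits at most
   [k] members.  So each added hyperedge hits on average at most
   [max (k - 1) (((d - 1) * k + 1) / d)] members of [O]. *)
Require Import Defs.
From mathcomp Require Import all_boot all_order all_algebra.
From mathcomp Require Import ring lra.

Set Implicit Arguments.
Unset Strict Implicit.
Unset Printing Implicit Defensive.

Import Order.TTheory GRing.Theory Num.Theory.
Local Open Scope ring_scope.

(** * Members of a matching hit by another family of hyperedges *)

Section Hit.
Variable T : finType.
Implicit Types (S f h : {set T}) (O M : {set {set T}}).

Definition hit O M : {set {set T}} :=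
  [set f in O | [exists g in M, ~~ [disjoint f & g]]].

Lemma hit0 O : hit O set0 = set0.
Proof.
apply/setP=> f; rewrite !inE; apply/negbTE; rewrite negb_and; apply/orP; right.
by apply/existsPn => g; rewrite inE.
Qed.

Lemma hitU1 O h M :
  hit O (h |: M) = hit O M :|: [set f in O | ~~ [disjoint f & h]].
Proof.
apply/setP=> f; rewrite !inE -andb_orr; congr (_ && _); apply/existsP/orP.
- case=> g; rewrite !inE => /andP[/orP[/eqP->|gM] fg]; first by right.
  by left; apply/existsP; exists g; rewrite gM.
- case=> [/existsP[g /andP[gM fg]]|fh]; first by exists g; rewrite !inE gM orbT.
  by exists h; rewrite !inE eqxx.
Qed.

(** Since [O] is a disjoint family, a member meeting [S] at [x] is recovered from [x] as
    [pblock O x]; so these members lie in the image of [S] under [pblock O]. *)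
Lemma card_meeting O S :
  trivIset O -> (#|[set f in O | ~~ [disjoint f & S]]| <= #|S|)%N.
Proof.
move=> tiO; apply: leq_trans (leq_imset_card (pblock O) S).
apply/subset_leq_card/subsetP=> f; rewrite inE => /andP[fO /pred0Pn[x]] /=.
by case/andP=> xf xS; apply/imsetP; exists x; rewrite // (def_pblock tiO fO xf).
Qed.

Lemma card_hitU1 O h M : (#|hit O (h |: M)| =
  #|hit O M| + #|[set f in O | ~~ [disjoint f & h]] :\: hit O M|)%N.
Proof.
rewrite -(cardsID (hit O M) (hit O (h |: M))) hitU1 setDUl setDv set0U.
by rewrite (setIidPr (subsetUl _ _)).
Qed.

End Hit.

(** * Counting the newly hit members at one arrival *)

Section Instance.
Variables (T : finType) (k : nat) (G : instance T k).
Implicit Types (h f : {set T}) (O M : {set {set T}}) (w : T).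

Lemma hedge_online w h :
  w \in online G -> h \in delta G w -> h :&: [set:: online G] = [set w].
Proof.
move=> wG; rewrite inE => /andP[hG wh]; apply/eqP; rewrite eq_sym eqEcard cards1.
by rewrite hedges_online // sub1set !inE wh wG.
Qed.

(** As [w] is the only online node of [h], what remains after removing it is exactly the offline
    part. *)
Lemma card_hedgeD1 w h :
  w \in online G -> h \in delta G w -> #|h :\ w| = (k - 1)%N.
Proof.
move=> wG hw; have hG : h \in hedges G by move: hw; rewrite inE => /andP[].
rewrite -(hedges_offline hG) -(hedge_online wG hw); congr #|pred_of_set _|.
apply/setP=> x; rewrite !inE; case xh: (x \in h) => //=; rewrite andbT.
have := subsetP (hedges_nodes hG) x xh; rewrite !inE.
case: (boolP (x \in offline G)) => [xo _|_ /= -> //].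
by apply/negP => xG; move/pred0P/(_ x): (online_offline G); rewrite /= xG xo.
Qed.

Lemma availableP O M w f :
  f \in O -> (f \in available G M w) = (f \in delta G w) && (f \notin hit O M).
Proof.
move=> fO; rewrite !inE fO /= negb_exists; congr (_ && _).
by apply: eq_forallb => g; rewrite negb_and negbK implybE.
Qed.

Lemma available_notin M w h : h \in available G M w -> h \notin M.
Proof.
rewrite !inE => /andP[/andP[_ wh] /forallP/(_ h)/implyP hM].
by apply/negP => /hM/pred0P/(_ w); rewrite /= wh.
Qed.

Variable O : {set {set T}}.
Hypothesis matchO : matching G O.

Let tiO : trivIset O. Proof. by case/andP: matchO. Qed.

Let new M h := [set f in O | ~~ [disjoint f & h]] :\: hit O M.

Lemma card_new_le M w h : (2 <= k)%N -> w \in online G ->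
  h \in available G M w -> (#|new M h| <= k)%N.
Proof.
move=> hk wG; rewrite inE => /andP[hw _].
apply: leq_trans (subset_leq_card (subsetDl _ _)) _.
apply: leq_trans (card_meeting _ tiO) _.
have wh : w \in h by move: hw; rewrite inE => /andP[].
by rewrite (cardsD1 w) wh card_hedgeD1 // subnKC // ltnW.
Qed.

Lemma card_new_self M f : f \in O -> (#|new M f| <= 1)%N.
Proof.
move=> fO; rewrite -(cards1 f); apply/subset_leq_card/subsetP=> g.
rewrite !inE => /andP[_ /andP[gO]]; apply: contraR => gf.
by move/trivIsetP: tiO; apply.
Qed.

(** A newly hit [f] cannot meet [h] at [w]: it would belong to [delta G w] while not being hit by
    [M], hence be available. So it meets [h :\ w], which has [k - 1] nodes. *)
Lemma card_new_offline M w h : w \in online G -> h \in available G M w ->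
  [disjoint O & available G M w] -> (#|new M h| <= k - 1)%N.
Proof.
move=> wG; rewrite inE => /andP[hw _] dOA.
rewrite -(card_hedgeD1 wG hw); apply: leq_trans (card_meeting _ tiO).
apply/subset_leq_card/subsetP=> f; rewrite in_setD !inE.
case/andP=> fM /andP[fO /pred0Pn[x /andP[/= xf xh]]]; rewrite fO /=.
apply/pred0Pn; exists x; rewrite /= xf !inE xh andbT /=; apply/eqP => xw.
move/pred0P/(_ f): dOA; rewrite /= fO (availableP _ _ fO) !inE -xw xf fO /= in fM *.
by rewrite fM andbT (subsetP (proj1 (andP matchO))).
Qed.

Lemma sum_card_new M w f : (2 <= k)%N -> w \in online G ->
  f \in O -> f \in available G M w ->
  (\sum_(h in available G M w) #|new M h| <= 1 + (#|available G M w| - 1) * k)%N.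
Proof.
move=> hk wG fO fA; rewrite (bigD1 f) //=; apply: leq_add; first exact: card_new_self.
rewrite (cardsD1 f) fA addKn -sum_nat_const.
rewrite (eq_bigl (fun h => h \in available G M w :\ f)) => [|h]; last by rewrite !inE andbC.
by apply: leq_sum => h; rewrite in_setD1 => /andP[_]; apply: card_new_le.
Qed.

(** * Expectations along the Markov chain *)

Section Expectation.
Variable R : realFieldType.

Lemma expect_step (F : {set {set T}} -> R) M w :
  \sum_M' random_step R G w M M' * F M' =
  if available G M w == set0 then F M
  else #|available G M w|%:R^-1 * \sum_(h in available G M w) F (h |: M).
Proof.
have sum_eq (N : {set {set T}}) : \sum_M' (M' == N)%:R * F M' = F N.
  rewrite (bigD1 N) //= eqxx mul1r big1 ?addr0 // => N' /negPf ->.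
  by rewrite mul0r.
rewrite /random_step; case: ifP => _; first exact: sum_eq.
under eq_bigr do rewrite mulr_suml.
rewrite exchange_big mulr_sumr /=; apply: eq_bigr => h _.
by rewrite -sum_eq mulr_sumr; apply: eq_bigr => M' _; rewrite mulrA.
Qed.

Lemma expect_rcons (F : {set {set T}} -> R) s w :
  \sum_M random_law R G (rcons s w) M * F M =
  \sum_M random_law R G s M * \sum_M' random_step R G w M M' * F M'.
Proof.
rewrite /random_law foldl_rcons; under eq_bigr do rewrite mulr_suml.
rewrite exchange_big /=; apply: eq_bigr => M _; rewrite mulr_sumr.
by apply: eq_bigr => M' _; rewrite mulrA.
Qed.

Lemma random_step_supp w M M' : random_step R G w M M' != 0 ->
  (available G M w = set0 /\ M' = M) \/
  (exists2 h, h \in available G M w & M' = h |: M).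
Proof.
rewrite /random_step; case: (available G M w =P set0) => [A0|_].
  by case: (M' =P M) => [->|_]; [left | rewrite eqxx].
move=> nz; right; case: (pickP (fun h => (h \in available G M w) && (M' == h |: M))).
  by move=> h /andP[hA /eqP ->]; exists h.
move=> none; case/eqP: nz; apply: big1 => h hA; move: (none h).
by rewrite hA /= => ->; rewrite mulr0.
Qed.

(** Once hit, [f] stays hit, so only the arrival of [w] itself matters. If [f] is not hit by then,
    it is available, so RANDOM must add some hyperedge through [w], and that one meets [f] at
    [w]. *)
Lemma random_law_hit s M f w : random_law R G s M != 0 ->
  w \in s -> f \in O -> w \in f -> f \in hit O M.
Proof.
elim/last_ind: s M => [|s u IHs] M //; rewrite /random_law foldl_rcons.
rewrite -/(random_law R G s) => nz ws fO wf.
have [N lawN stepN] : exists2 N, random_law R G s N != 0 & random_step R G u N M != 0.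
  case: (pickP (fun N => random_law R G s N * random_step R G u N M != 0)).
    by move=> N; rewrite mulf_eq0 negb_or => /andP[]; exists N.
  move=> none; case/eqP: nz; apply: big1 => N _.
  by apply/eqP; rewrite -[_ == _]negbK none.
(* If [w] arrived before [u], induction already gives the hit. *)
have hitN : f \notin hit O N -> w = u.
  move: ws; rewrite mem_rcons inE => /orP[/eqP//|ws].
  by rewrite (IHs N lawN ws fO wf).
have fG : f \in hedges G by apply: (subsetP (proj1 (andP matchO))).
case: (random_step_supp stepN) => [[A0 ->]|[h hA ->]].
  apply/negPn/negP => fN; have : f \in available G N u.
    by rewrite (availableP _ _ fO) fN inE fG -(hitN fN) wf.
  by rewrite A0 inE.
rewrite hitU1 in_setU; case fN: (f \in hit O N) => //=; rewrite !inE fO /=.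
move: hA; rewrite -hitN ?fN // !inE => /andP[/andP[_ wh] _].
by apply/pred0Pn; exists w; rewrite /= wf.
Qed.

Lemma random_law_hit_all M : random_law R G (online G) M != 0 -> hit O M = O.
Proof.
move=> nz; apply/eqP; rewrite eqEsubset; apply/andP; split.
  by apply/subsetP => f; rewrite inE => /andP[].
apply/subsetP => f fO.
have fG : f \in hedges G by apply: (subsetP (proj1 (andP matchO))).
have /card_gt0P[w /setIP[wf wG]] : (0 < #|f :&: [set:: online G]|)%N.
  by rewrite hedges_online.
by rewrite inE in wG; apply: random_law_hit nz wG fO wf.
Qed.

Variables (d : nat) (r : R).
Hypotheses (hk : (2 <= k)%N) (r_ge0 : 0 <= r).
Hypothesis hdeg : forall w, w \in online G -> (degree G w <= d)%N.
(** For [d] at least 1, the minimum in the theorem is the largest [r] meeting both conditions. *)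
Hypotheses (r_offline : r * (k%:R - 1) <= 1) (r_avg : r * ((d%:R - 1) * k%:R + 1) <= d%:R).

(** This starts at 0, does not decrease in expectation at any arrival, and almost surely ends as
    [#|M| - r * #|O|], because every member of [O] is hit by then. *)
Let potential M : R := #|M|%:R - r * #|hit O M|%:R.

Lemma sum_new_bound M w : w \in online G ->
  r * (\sum_(h in available G M w) #|new M h|)%:R <= #|available G M w|%:R.
Proof.
move=> wG; set A := available G M w.
case: (boolP [disjoint O & A]) => [dOA|/pred0Pn[f /andP[/= fO fA]]].
  apply: (@le_trans _ _ (r * (#|A| * (k - 1))%N%:R)).
    rewrite ler_wpM2l // ler_nat -sum_nat_const; apply: leq_sum => h hA.
    exact: card_new_offline hA dOA.
  rewrite natrM natrB ?(ltnW hk) // mulrCA -[leRHS]mulr1.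
  by rewrite ler_wpM2l.
have A_gt0 : (0 < #|A|)%N by apply/card_gt0P; exists f.
have A_le : #|A|%:R <= d%:R :> R.
  rewrite ler_nat; apply: leq_trans (hdeg wG).
  by apply/subset_leq_card/subsetP => h; rewrite inE => /andP[].
apply: (@le_trans _ _ (r * (1 + (#|A| - 1) * k)%N%:R)).
  by rewrite ler_wpM2l // ler_nat (sum_card_new hk wG fO fA).
rewrite natrD natrM natrB //.
move: r_avg; have : (1 <= #|A|%:R :> R) by rewrite ler1n.
have : 1 <= k%:R :> R by rewrite ler1n ltnW.
move: (#|A|%:R) (d%:R) (k%:R : R) A_le => a d' K aD K1 a1 avg.
(* The goal amounts to [0 <= a * (1 - r * K) + r * (K - 1)]. If [r * K <= 1], both terms are
   nonnegative. Otherwise the right side decreases in [a], so the worst case is [a = d'], which is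
   [avg]. *)
case: (leP (r * K) 1) => rK.
  have : 0 <= a * (1 - r * K) by rewrite mulr_ge0 ?subr_ge0 // (le_trans ler01).
  have : 0 <= r * (K - 1) by rewrite mulr_ge0 ?subr_ge0.
  lra.
have : 0 <= (d' - a) * (r * K - 1) by rewrite mulr_ge0 ?subr_ge0 // ltW.
lra.
Qed.

Lemma potential_step M w : w \in online G ->
  potential M <= \sum_M' random_step R G w M M' * potential M'.
Proof.
move=> wG; rewrite expect_step; case: ifP => // /negbT A0.
set A := available G M w in A0 *.
have A_gt0 : 0 < #|A|%:R :> R by rewrite ltr0n card_gt0.
rewrite mulrC ler_pdivlMr //.
(* An available [h] is not yet in [M], so adding it raises the size by exactly 1. The claim then
   reduces to the sum of these increments being nonnegative. *)
rewrite (eq_bigr (fun h => potential M + (1 - r * #|new M h|%:R))); last first.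
  move=> h /available_notin hM; rewrite /potential card_hitU1 cardsU1 hM !natrD.
  rewrite -/(new M h) /=; ring.
rewrite big_split sumr_const -[potential M *+ _]mulr_natr lerDl sumrB sumr_const.
by rewrite -mulr_sumr -natr_sum subr_ge0 sum_new_bound.
Qed.

Lemma expect_potential_ge0 s : {subset s <= online G} ->
  0 <= \sum_M random_law R G s M * potential M.
Proof.
elim/last_ind: s => [_|s w IHs sG].
  rewrite /random_law /= (bigD1 set0) //= eqxx big1 => [|M /negPf->]; last exact: mul0r.
  by rewrite /potential hit0 !cards0 mulr0 subr0 mulr0 addr0.
rewrite expect_rcons; apply: le_trans (IHs _) _ => [u us|].
  by rewrite sG // mem_rcons inE us orbT.
apply: ler_sum => M _; rewrite ler_wpM2l ?random_law_ge0 //.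
by rewrite potential_step // sG // mem_rcons mem_head.
Qed.

Lemma matching_expected_size : r * #|O|%:R <= expected_size R G.
Proof.
rewrite -subr_ge0; suff -> : expected_size R G - r * #|O|%:R =
    \sum_M random_law R G (online G) M * potential M.
  exact: expect_potential_ge0.
(* Total mass 1 turns the constant [r * #|O|] into an expectation, so that the two sides can be
   compared matching by matching on the support of the law. *)
rewrite -[r * _]mul1r -[X in X * (r * _)](sum_random_law R G (online G)).
rewrite mulr_suml -sumrB.
apply: eq_bigr => M _; have [->|nz] := eqVneq (random_law R G (online G) M) 0.
  by rewrite !mul0r subr0.
by rewrite /potential random_law_hit_all // mulrBr.
Qed.

End Expectation.
End Instance.

Theorem theorem1p2 (R : realFieldType) (k d : nat) (hk : (2 <= k)%N)
    (hd : (1 <= d)%N) (T : finType) (G : instance T k)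
    (hdeg : forall w, w \in online G -> (degree G w <= d)%N) :
  Num.min (1 / (k%:R - 1)) (d%:R / ((d%:R - 1) * k%:R + 1)) * (OPT G)%:R
    <= expected_size R G.
Proof.
have k1_gt0 : 0 < k%:R - 1 :> R by rewrite subr_gt0 ltr1n.
have den_gt0 : 0 < (d%:R - 1) * k%:R + 1 :> R.
  by rewrite ltr_wpDl // mulr_ge0 // subr_ge0 ler1n.
set r := Num.min _ _.
have r_ge0 : 0 <= r by rewrite le_min !divr_ge0 // ltW.
have r_offline : r * (k%:R - 1) <= 1 by rewrite -ler_pdivlMr // ge_min lexx.
have r_avg : r * ((d%:R - 1) * k%:R + 1) <= d%:R.
  by rewrite -ler_pdivlMr // ge_min lexx orbT.
(* The bound passes to a maximum of two values, so it suffices to prove it for 0 and for the size of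
   each matching [O]. *)
rewrite /OPT; elim/big_ind: _ => [|m n Hm Hn|O matchO].
- by rewrite mulr0; apply: sumr_ge0 => M _; rewrite mulr_ge0 ?random_law_ge0.
- by case: (leqP m n).
- exact: (@matching_expected_size _ _ _ _ matchO _ d).
Qed.
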